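(* Let $X=\operatorname{Cay}(\mathbb{Z}_n,\{\pm a,\pm b\})$ be a circulant graph of valency $4$. Then $X$ is unstable if and only if either $X$ is trivially unstable, or (perhaps after interchanging $a$ and $b$) one of the following holds: (1) $n\equiv 2\pmod 4$, $\gcd(a,n)=1$, and $b=ma+(n/2)$ for some $m\in\mathbb{Z}_n^\times$ with $m^2\equiv\pm1\pmod n$; or (2) $n$ is divisible by $8$ and $\gcd(|a|,|b|)=4$. Moreover, in both cases (1) and (2), $X$ has Wilson type (C.4), i.e., there exists $m\in\mathbb{Z}_n^\times$ with $(n/2)+m\{\pm a,\pm b\}=\{\pm a,\pm b\}$.
   Context: All graphs are finite, undirected and simple. $\operatorname{Cay}(\mathbb{Z}_n,S)$ (with $S\subseteq\mathbb{Z}_n\setminus\{0\}$, $S=-S$) has vertex set $\mathbb{Z}_n$ and $v\sim w$ iff $w-v\in S$. For $x\in\mathbb{Z}_n$, $|x|=n/\gcd(n,x)$ denotes the order of $x$ in $\mathbb{Z}_n$. The canonical bipartite double cover $BX$ has vertex set $V(X)\times\{0,1\}$, with $(v,0)\sim(w,1)$ iff $v\sim w$ in $X$. $X$ is unstable if $\operatorname{Aut}BX\neq\operatorname{Aut}X\times S_2$. A graph is twin-free if no two distinct vertices have the same neighbourhood. $X$ is nontrivially unstable if it is connected, nonbipartite, twin-free and unstable; it is trivially unstable if it is unstable but not nontrivially unstable (equivalently, it has more than one vertex and is disconnected, bipartite, or not twin-free). *)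

(* Defs.v *)
From HB Require Import structures.
From mathcomp Require Import all_boot all_order all_algebra all_fingroup.

Set Implicit Arguments.
Unset Strict Implicit.
Unset Printing Implicit Defensive.

Import GRing.Theory.
Local Open Scope ring_scope.

(* A finite simple graph is a symmetric irreflexive relation on a finType. *)

Section Graphs.
Variables (V : finType) (e : rel V).

Definition nbhd (v : V) : {set V} := [set w | e v w].

Definition has_valency (k : nat) : Prop := forall v, #|nbhd v| = k.

Definition graph_connected : Prop := forall v w, connect e v w.

Definition graph_bipartite : Prop :=
  exists A : {set V}, forall v w, e v w -> (v \in A) != (w \in A).

Definition twin_free : Prop := forall v w, nbhd v = nbhd w -> v = w.

Definition graph_aut : {set {perm V}} :=
  [set s : {perm V} | [forall v, forall w, e (s v) (s w) == e v w]].

Definition double_cover : rel (V * 'I_2) :=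
  fun p q => (p.2 != q.2) && e p.1 q.1.

End Graphs.

Section ProductPerm.
Variables (V : finType) (s : {perm V} * 'S_2).

Definition prod_perm_fun (p : V * 'I_2) : V * 'I_2 := (s.1 p.1, s.2 p.2).

Lemma prod_perm_fun_inj : injective prod_perm_fun.
Proof. by move=> [v i] [w j] [/perm_inj-> /perm_inj->]. Qed.

Definition prod_perm : {perm V * 'I_2} := perm prod_perm_fun_inj.

End ProductPerm.

Section Stability.
Variables (V : finType) (e : rel V).

(* Aut X x S_2, as the group of permutations (v, i) |-> (s v, t i) of the
   vertex set of the double cover. *)
Definition aut_times_S2 : {set {perm V * 'I_2}} :=
  [set prod_perm s | s in setX (graph_aut e) [set: 'S_2]].

Definition unstable : Prop := graph_aut (double_cover e) <> aut_times_S2.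

Definition nontrivially_unstable : Prop :=
  [/\ graph_connected e, ~ graph_bipartite e, twin_free e & unstable].

Definition trivially_unstable : Prop := unstable /\ ~ nontrivially_unstable.

End Stability.

(* 'Z_n is the ring of integers mod n only for n > 1. *)
Section Circulants.
Variable n : nat.

Definition Cay (S : {set 'Z_n}) : rel 'Z_n := fun v w => w - v \in S.

Definition pm_set (a b : 'Z_n) : {set 'Z_n} := [set a; - a; b; - b].

Definition Zn_order (x : 'Z_n) : nat := (n %/ gcdn n x)%N.

Definition case1 (a b : 'Z_n) : Prop :=
  [/\ n = 2 %[mod 4], gcdn a n = 1%N &
      exists m : 'Z_n, [/\ m \is a GRing.unit,
        m ^+ 2 = 1 \/ m ^+ 2 = -1 & b = m * a + (n %/ 2)%:R]].

Definition case2 (a b : 'Z_n) : Prop :=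
  (8 %| n)%N /\ gcdn (Zn_order a) (Zn_order b) = 4%N.

(* n/2 only makes sense for n even. *)
Definition wilson_C4 (S : {set 'Z_n}) : Prop :=
  ~~ odd n /\ exists2 m : 'Z_n, m \is a GRing.unit &
    [set (n %/ 2)%:R + m * s | s in S] = S.

End Circulants.

Lemma Cay_sym n (a b : 'Z_n) : symmetric (Cay (pm_set a b)).
Proof.
move=> v w; rewrite /Cay /pm_set -(opprB v w) !inE !eqr_oppLR !opprK.
by do !case: (_ == _).
Qed.

Lemma Cay_irr n (S : {set 'Z_n}) : 0 \notin S -> irreflexive (Cay S).
Proof. by move=> S0 v; rewrite /Cay subrr (negPf S0). Qed.

(* Main.v *)
Require Import Defs.
From HB Require Import structures.
From mathcomp Require Import all_boot all_order all_algebra all_fingroup.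
From mathcomp Require Import ring zify.
From Stdlib Require Classical_Prop.

(** An automorphism of the double cover of a connected nonbipartite graph is, up
to swapping the two sides, a pair [f, g] of vertex permutations with
[f x ~ g y] iff [x ~ y], and [X] is unstable iff some such pair has [f <> g].
Let [S] be the connection set. If [x + r] and [x - r] have [x] as their only
common neighbour for some [r] in [S], then the map [s |-> g (x + s) - f x]
induced on [S] commutes with negation, i.e. straight paths go to straight
paths. Unless some element of [S] is three times another, 4-cycles are
moreover rigid enough for this map not to depend on [x]; then
[f x = f 0 + m * x] and [g - f] is a constant [c] with [2 c = 0], so that
[c = n / 2] and [m S + n / 2 = S]. If [S] is [{r, - r, 3 r, - 3 r}], then [n] is
odd, and straightness alone forces [2 (g - f) = 0], that is, [f = g] (when
[5 r = 0] the graph is complete). Reading [m S + n / 2 = S] modulo 2, and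
comparing [m] with [1] and [-1] modulo the orders of [a] and [b], gives the two
families. *)

Set Implicit Arguments.
Unset Strict Implicit.
Unset Printing Implicit Defensive.

Import GRing.Theory.
Local Open Scope ring_scope.

Lemma connect_invariant (V : finType) (e : rel V) (P : V -> Prop) x y :
  P x -> (forall v w, P v -> e v w -> P w) -> connect e x y -> P y.
Proof.
move=> Px Pe /connectP[p + ->] {y}.
by elim: p x Px => //= v p IHp x Px /andP[exv]; apply: IHp; apply: Pe exv.
Qed.

(** * Automorphisms of the double cover as pairs of vertex maps *)

Section ConnectedNonbipartite.

Variables (V : finType) (e : rel V).
Hypotheses (conn : graph_connected e) (nbip : ~ graph_bipartite e).

(* [F0] and [F1] are the two halves of a function on the double cover that is
   constant along edges, and the double cover is connected. *)
Lemma alternating_const (T : eqType) (F0 F1 : V -> T) :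
  (forall x y, e x y -> F0 x = F1 y) -> (forall x y, e x y -> F1 x = F0 y) ->
  forall x y, F0 x = F1 y.
Proof.
move=> F01 F10 x y.
have Fxy v : F0 v = F0 x /\ F1 v = F1 x \/ F0 v = F1 x /\ F1 v = F0 x.
  pose P v := F0 v = F0 x /\ F1 v = F1 x \/ F0 v = F1 x /\ F1 v = F0 x.
  apply: (connect_invariant (P := P) _ _ (conn x v)); rewrite /P; first by left.
  move=> {}v w [[<- <-]|[<- <-]] evw; rewrite (F01 _ _ evw) (F10 _ _ evw).
    by right.
  by left.
(* If the two values differed, the vertices where [F0] takes the value [F0 x] would form one side of
   a bipartition. *)
have [F0x|F0x] := eqVneq (F0 x) (F1 x); first by case: (Fxy y) => -[_ ->].
case: nbip; exists [set v | F0 v == F0 x] => v w evw; rewrite !inE.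
rewrite eq_sym in F0x.
by case: (Fxy v) => -[F0v F1v]; rewrite F0v -(F10 _ _ evw) F1v eqxx (negPf F0x).
Qed.

Let o0 : 'I_2 := ord0.
Let o1 : 'I_2 := ord_max.

Let o2P (i : 'I_2) : i = o0 \/ i = o1.
Proof.
by case: i => -[|[|i]] lti; [left; apply: val_inj|right; apply: val_inj|].
Qed.

Let ord2_eq (i j k : 'I_2) : i != j -> k != j -> i = k.
Proof. by case: (o2P i) (o2P j) (o2P k) => -> [] -> [] ->. Qed.

(** The maps are the first coordinates, on the two sides, of an automorphism outside
    [aut_times_S2 e]; were they equal, it would be a product. *)
Lemma unstable_two_fold : unstable e ->
  exists f g : V -> V, [/\ injective f, injective g,
    forall x y, e (f x) (g y) = e x y & exists x, f x <> g x].
Proof.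
have o01 : o0 != o1 by [].
move=> unst.
have [alpha aut_a nprod] : exists2 alpha,
    alpha \in graph_aut (double_cover e) & alpha \notin aut_times_S2 e.
  apply/exists_inP; apply: contra_notT unst => /exists_inPn sub.
  apply/setP=> s; apply/idP/idP; first by move/sub; rewrite negbK.
  case/imsetP=> -[u v]; rewrite !inE /= andbT => /forallP autu ->.
  apply/forallP=> -[x i]; apply/forallP=> -[y j].
  rewrite !permE /double_cover /= (inj_eq perm_inj).
  by move/forallP: (autu x) => /(_ y)/eqP->.
have autE p q : double_cover e (alpha p) (alpha q) = double_cover e p q.
  by move: aut_a; rewrite inE => /forallP/(_ p)/forallP/(_ q)/eqP.
have side_edge p q : double_cover e p q -> (alpha p).2 != (alpha q).2.
  by rewrite -autE => /andP[].
(* Whether a vertex keeps its side is constant along edges, so the automorphism preserves both sides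
   or swaps them. *)
have side x y : ((alpha (x, o0)).2 == o0) = ((alpha (y, o1)).2 == o1).
  apply: (@alternating_const _ (fun x => (alpha (x, o0)).2 == o0)
            (fun y => (alpha (y, o1)).2 == o1)) => {}x {}y exy.
    have /side_edge : double_cover e (x, o0) (y, o1) by rewrite /double_cover.
    by case: (o2P (alpha (x, o0)).2) (o2P (alpha (y, o1)).2) => -> [] ->.
  have /side_edge : double_cover e (x, o1) (y, o0) by rewrite /double_cover.
  by case: (o2P (alpha (x, o1)).2) (o2P (alpha (y, o0)).2) => -> [] ->.
have side_neq x y : (alpha (x, o0)).2 != (alpha (y, o1)).2.
  move: (side x y).
  by case: (o2P (alpha (x, o0)).2) (o2P (alpha (y, o1)).2) => -> [] ->.
have side0 x y : (alpha (x, o0)).2 = (alpha (y, o0)).2.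
  exact: ord2_eq (side_neq x x) (side_neq y x).
have side1 x y : (alpha (x, o1)).2 = (alpha (y, o1)).2.
  by apply: (@ord2_eq _ (alpha (x, o0)).2); rewrite eq_sym side_neq.
exists (fun x => (alpha (x, o0)).1), (fun x => (alpha (x, o1)).1).
have inj i : (forall x y, (alpha (x, i)).2 = (alpha (y, i)).2) ->
    injective (fun x => (alpha (x, i)).1).
  move=> sidei x y /= eqf; have: alpha (x, i) = alpha (y, i).
    by apply: injective_projections => //; apply: sidei.
  by move/perm_inj => -[].
have edge x y : e (alpha (x, o0)).1 (alpha (y, o1)).1 = e x y.
  by have := autE (x, o0) (y, o1); rewrite /double_cover side_neq.
split=> //; [exact: inj|exact: inj|].
case: (pickP (fun x => (alpha (x, o0)).1 != (alpha (x, o1)).1)) => [x /eqP|eqfg].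
  by exists x.
have {}eqfg x : (alpha (x, o0)).1 = (alpha (x, o1)).1 by apply/eqP/negbFE/eqfg.
case/negP: nprod; apply/imsetP.
(* The side permutation is read off at a vertex [x0]; the empty graph is treated apart. *)
have [x0 _|noV] := pickP (@predT V); last first.
  exists (1%g, 1%g); last by apply/permP=> -[x i]; case/negP: (noV x).
  by rewrite !inE andbT; apply/forallP=> v; case/negP: (noV v).
have t_inj : injective (fun i => (alpha (x0, i)).2).
  move=> i j; move: (side_neq x0 x0).
  by case: (o2P i) (o2P j) => -> [] -> //; [|rewrite eq_sym] => /eqP.
exists (perm (inj o0 side0), perm t_inj).
  rewrite !inE andbT; apply/forallP=> v; apply/forallP=> w.
  by rewrite !permE [X in e _ X]eqfg edge.
apply/permP=> -[x i]; rewrite permE /prod_perm_fun /= !permE.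
apply: injective_projections => /=.
  by case: (o2P i) => ->.
by case: (o2P i) => ->.
Qed.

End ConnectedNonbipartite.

(** * Opposite directions at a vertex *)

Section LocalStructure.

Variables (n : nat) (S : {set 'Z_n}) (f g : 'Z_n -> 'Z_n) (r : 'Z_n).
Hypotheses (S_opp : forall s, s \in S -> - s \in S)
  (S_four : forall s t u, s \in S -> t \in S -> u \in S -> t != s -> t != - s ->
     [|| u == s, u == - s, u == t | u == - t])
  (f_inj : injective f) (g_inj : injective g)
  (fg : forall x y, (g y - f x \in S) = (y - x \in S))
  (S_dbl : forall s, s \in S -> s + s != 0)
  (Sr : r \in S)
  (r_uniq : forall u, u \in S -> u + (r + r) \in S -> u = - r).

Lemma dir_in x s : s \in S -> g (x + s) - f x \in S.
Proof. by move=> Ss; rewrite fg addrC addKr. Qed.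

(** As [f] is onto, [z = f w] with [w] a common neighbour of [x + r] and [x - r]; by [r_uniq], only
    [x] is one. *)
Lemma common_nbr_unique x z :
  g (x + r) - z \in S -> g (x - r) - z \in S -> z = f x.
Proof.
have [w ->] : exists w, z = f w.
  by have /codomP[w ->] := injF_onto f_inj z; exists w.
rewrite !fg => S1 S2; congr f.
have /r_uniq : x - r - w \in S by [].
have -> : x - r - w + (r + r) = x + r - w by ring.
by move=> /(_ S1) eq; rewrite -[w]addr0 -(subrr (x - r - w)) {2}eq; ring.
Qed.

(** With [s] and [t] the image directions of [r] and [- r], the vertex [f x + (s + t)] is adjacent
    to both [g (x + r)] and [g (x - r)], so it is [f x]. *)
Lemma opp_dir_r x : g (x - r) - f x = - (g (x + r) - f x).
Proof.
set t := g (x - r) - f x; set s := g (x + r) - f x.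
have Ss : s \in S by apply: dir_in.
have St : t \in S by rewrite /t; apply: dir_in; apply: S_opp.
suff : f x + (s + t) = f x.
  by move=> e; apply/eqP; rewrite -addr_eq0 addrC -(inj_eq (addrI (f x))) addr0 e.
apply: common_nbr_unique.
  have -> : g (x + r) - (f x + (s + t)) = - t by rewrite /s; ring.
  exact: S_opp.
have -> : g (x - r) - (f x + (s + t)) = - s by rewrite /t; ring.
exact: S_opp.
Qed.

(** The images of [r] and [- r] use up one opposite pair of [S]; as [g] is injective, the remaining
    directions must fill the other pair. *)
Lemma opp_dir x s : s \in S -> g (x - s) - f x = - (g (x + s) - f x).
Proof.
move=> Ss; have [->|sr] := eqVneq s r; first exact: opp_dir_r.
have [->|sNr] := eqVneq s (- r); first by rewrite opprK opp_dir_r opprK.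
have dirI u v : g (x + u) - f x = g (x + v) - f x -> u = v.
  by move/addIr/g_inj/addrI.
have := S_four (dir_in x Sr) (dir_in x Ss) (dir_in x (S_opp Ss)).
rewrite -opp_dir_r => /(_ _ _)/or4P[].
- by apply: contra_neq sr => /dirI.
- by apply: contra_neq sNr => /dirI.
- by move/eqP/dirI => e; rewrite -e opprK eqxx in sNr.
- by move/eqP/dirI/oppr_inj => e; rewrite e eqxx in sr.
- by move/eqP/dirI/esym/eqP; rewrite -addr_eq0 (negPf (S_dbl Ss)).
- by move/eqP.
Qed.

End LocalStructure.

(** Reduces deducing one linear equation from another to an identity that [ring] checks. *)
Lemma eq_of_sub (V : zmodType) (u v x y : V) : u = v -> x - y = u - v -> x = y.
Proof. by move=> -> e; apply/eqP; rewrite -subr_eq0 e subrr. Qed.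

(** * Directions along paths of length two *)

Section Turns.

Variables (n : nat) (S : {set 'Z_n}) (f g : 'Z_n -> 'Z_n) (r : 'Z_n).
Hypotheses (S_opp : forall s, s \in S -> - s \in S)
  (S_dbl : forall s, s \in S -> s + s != 0)
  (S_four : forall s t u, s \in S -> t \in S -> u \in S -> t != s -> t != - s ->
     [|| u == s, u == - s, u == t | u == - t])
  (f_inj : injective f) (g_inj : injective g)
  (fg : forall x y, (g y - f x \in S) = (y - x \in S))
  (Sr : r \in S) (r_uniq : forall u, u \in S -> u + (r + r) \in S -> u = - r).

Lemma fg_swap x y : (f y - g x \in S) = (y - x \in S).
Proof.
have SN u : (- u \in S) = (u \in S).
  by apply/idP/idP => /S_opp; rewrite ?opprK.
by rewrite -SN opprB fg -SN opprB.
Qed.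

(** This is [opp_dir] with [f] and [g] exchanged, at the middle vertex [x + s]. *)
Lemma straight x s : s \in S -> f (x + s + s) - g (x + s) = g (x + s) - f x.
Proof.
move=> Ss.
have := opp_dir S_opp S_four g_inj f_inj fg_swap S_dbl Sr r_uniq (x + s) Ss.
by rewrite addrK => e; rewrite -[RHS]opprB e opprK.
Qed.

(** The paths through [x + s] and [x + t] have images with common ends [f x] and [f (x + s + t)]. By
    [S_quad] these images bound a parallelogram unless they return to [f x], which injectivity of
    [f] excludes. The cases [t = s] and [t = - s] are straightness. *)
Lemma turn x s t :
  (forall s t u v, s \in S -> t \in S -> u \in S -> v \in S ->
     t != s -> t != - s -> s + u = t + v -> u = - s \/ u = t) ->
  s \in S -> t \in S -> f (x + s + t) - g (x + s) = g (x + t) - f x.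
Proof.
move=> S_quad Ss St; have [->|ts] := eqVneq t s; first exact: straight.
have oppd := opp_dir S_opp S_four f_inj g_inj fg S_dbl Sr r_uniq.
have [->|tNs] := eqVneq t (- s); first by rewrite addrK oppd // opprB.
have dirI u v : g (x + u) - f x = g (x + v) - f x -> u = v.
  by move/addIr/g_inj/addrI.
have := S_quad (g (x + s) - f x) (g (x + t) - f x)
  (f (x + s + t) - g (x + s)) (f (x + s + t) - g (x + t)).
rewrite !fg !fg_swap.
have -> : x + s - x = s by ring.
have -> : x + t - x = t by ring.
have -> : x + s + t - (x + s) = t by ring.
have -> : x + s + t - (x + t) = s by ring.
case=> //.
- by apply: contra_neq ts => /dirI.
- by rewrite -oppd //; apply: contra_neq tNs => /dirI.
- ring.
- rewrite opprB => /addIr/f_inj e; case/eqP: tNs.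
  by apply: (eq_of_sub e); ring.
Qed.

End Turns.

Lemma Cay_edge n (S : {set 'Z_n}) (P : 'Z_n -> 'Z_n -> Prop) :
  (forall x s, s \in S -> P x (x + s)) -> forall x y, Cay S x y -> P x y.
Proof. by move=> PS x y /(PS x); rewrite addrC subrK. Qed.

(** * Rigidity of the pair [f], [g] *)

Section TwoFold.

Variables (n : nat) (S : {set 'Z_n}) (f g : 'Z_n -> 'Z_n).
Hypotheses (S_opp : forall s, s \in S -> - s \in S)
  (S_dbl : forall s, s \in S -> s + s != 0)
  (S_four : forall s t u, s \in S -> t \in S -> u \in S -> t != s -> t != - s ->
     [|| u == s, u == - s, u == t | u == - t])
  (conn : graph_connected (Cay S)) (nbip : ~ graph_bipartite (Cay S))
  (f_inj : injective f) (g_inj : injective g)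
  (fg : forall x y, (g y - f x \in S) = (y - x \in S)).

(** Connectedness means that [S] generates ['Z_n]. *)
Lemma Cay_ind (P : 'Z_n -> Prop) :
  P 0 -> (forall x s, P x -> s \in S -> P (x + s)) -> forall x, P x.
Proof.
move=> P0 PS x; apply: connect_invariant (conn 0 x) => // v w Pv /(PS v).
by move=> /(_ Pv); rewrite addrC subrK.
Qed.

Lemma alternating_Cay (F0 F1 : 'Z_n -> 'Z_n) :
  (forall x s, s \in S -> F0 x = F1 (x + s)) ->
  (forall x s, s \in S -> F1 x = F0 (x + s)) -> forall x y, F0 x = F1 y.
Proof.
by move=> F01 F10; apply: (alternating_const conn nbip); apply: Cay_edge.
Qed.

Lemma two_fold_affine r : r \in S ->
  (forall u, u \in S -> u + (r + r) \in S -> u = - r) ->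
  (forall s t u v, s \in S -> t \in S -> u \in S -> v \in S ->
     t != s -> t != - s -> s + u = t + v -> u = - s \/ u = t) ->
  (exists x, f x <> g x) ->
  exists m c : 'Z_n, [/\ m \is a GRing.unit, c != 0, c + c = 0 &
    forall s, s \in S -> m * s + c \in S].
Proof.
move=> Sr r_uniq S_quad [x0 fgx0].
have gf := fg_swap S_opp fg.
(* By [turn], a step along any edge exchanges the two sides of this equation, so both are
   constant. *)
have dirE t x y : t \in S -> g (x + t) - f x = f (y + t) - g y.
  move=> St; move: x y.
  apply: (alternating_Cay (F0 := fun x => _) (F1 := fun x => _)) => x s Ss.
    by rewrite (turn S_opp S_dbl S_four f_inj g_inj fg Sr).
  by rewrite (turn S_opp S_dbl S_four g_inj f_inj gf Sr).
have diffE x y : g x - f x = f y - g y.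
  move: x y; apply: (alternating_Cay (F0 := fun x => _) (F1 := fun x => _)).
    by move=> x s /(dirE s x x) e; apply: (eq_of_sub e); ring.
  by move=> x s /(dirE s x x) /esym e; apply: (eq_of_sub e); ring.
pose c := g 0 - f 0.
have gE x : g x = f x + c.
  have e : g x - f x = g 0 - f 0 by rewrite (diffE x 0) (diffE 0 0).
  by apply: (eq_of_sub e); rewrite /c; ring.
have c2 : c + c = 0 by apply: (eq_of_sub (diffE 0 0)); rewrite /c; ring.
have cn0 : c != 0.
  by apply: contra_notN fgx0 => /eqP c0; rewrite gE c0 addr0.
have fS x s : s \in S -> f (x + s) = f x + (f s - f 0).
  move=> Ss; have := dirE s x 0 Ss; rewrite -(dirE s 0 0 Ss) !gE add0r => e.
  by apply: (eq_of_sub e); ring.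
have fD x y : f (x + y) = f x + (f y - f 0).
  elim/Cay_ind: y => [|y s IHy Ss]; first by rewrite addr0; ring.
  by rewrite addrA !(fS _ s) // IHy; ring.
(* Being additive up to a translation, [f] is affine, as 1 generates ['Z_n]. *)
pose m := f 1 - f 0.
have fE x : f x = f 0 + m * x.
  rewrite -[x]natr_Zp; elim: (nat_of_ord x) => [|k IHk]; first by ring.
  by rewrite -natr1 fD IHk /m; ring.
exists m, c; split=> //.
  (* The preimage [w] of [f 0 + 1] is an inverse of [m]. *)
  have /codomP[w e] := injF_onto f_inj (f 0 + 1).
  apply/unitrPr; exists w; apply: (@addrI _ (f 0)).
  by rewrite -fE -e.
move=> s Ss; have : g s - f 0 \in S by rewrite fg subr0.
by rewrite gE fE; congr (_ \in S); ring.
Qed.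

(** Common neighbours are not unique along [r], because [r + (r + r)] is again in [S]. Uniqueness
    along [r *+ 3] still gives straightness for every direction, in particular for [r]. *)
Lemma two_fold_triple_eq r :
  r \in S -> r *+ 3 \in S -> r *+ 3 != r -> r *+ 3 != - r ->
  (forall c : 'Z_n, c + c = 0 -> c = 0) ->
  (forall u, u \in S -> u + (r *+ 3 + r *+ 3) \in S -> u = - (r *+ 3)) ->
  forall x, f x = g x.
Proof.
move=> Sr S3r nr nNr odd_n r3_uniq.
have gf := fg_swap S_opp fg.
(* Every element of [S] is an odd multiple of [r], so alternation along [r] gives alternation along
   all edges. *)
have alt3 (F0 F1 : 'Z_n -> 'Z_n) : (forall x, F1 (x + r) = F0 x) ->
    (forall x, F0 (x + r) = F1 x) -> forall x y, F0 x = F1 y.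
  move=> F10 F01.
  have stepN x : F1 (x - r) = F0 x /\ F0 (x - r) = F1 x.
    by split; [rewrite -F01|rewrite -F10]; rewrite subrK.
  have step x s : s \in S -> F1 (x + s) = F0 x /\ F0 (x + s) = F1 x.
    move=> Ss; case/or4P: (S_four Sr S3r Ss nr nNr) => /eqP-> //.
    - by rewrite !mulrSr mulr0n add0r !addrA F10 F01 F10 F01 F10 F01.
    - rewrite !mulrSr mulr0n add0r !opprD !addrA.
      by rewrite !(stepN _).1 !(stepN _).2 !(stepN _).1 !(stepN _).2.
  by apply: alternating_Cay => x s /(step x)[].
have dirE x y : g (x + r) - f x = f (y + r) - g y.
  move: x y; apply: (alt3 (fun x => _) (fun x => _)) => x.
    exact: (straight S_opp S_dbl S_four f_inj g_inj fg S3r r3_uniq).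
  exact: (straight S_opp S_dbl S_four g_inj f_inj gf S3r r3_uniq).
have diffE x y : g x - f x = f y - g y.
  move: x y; apply: (alt3 (fun x => _) (fun x => _)).
    by move=> x; have /esym e := dirE x x; apply: (eq_of_sub e); ring.
  by move=> x; have e := dirE x x; apply: (eq_of_sub e); ring.
move=> x; apply/eqP; rewrite -subr_eq0; apply/eqP/odd_n.
by apply: (eq_of_sub (esym (diffE x x))); ring.
Qed.

End TwoFold.

(** * Involutions and parity modulo [n] *)

Section Zn.

Variable n : nat.
Hypothesis n_gt1 : (1 < n)%N.

Lemma Zn_nat_eq0 k : ((k%:R : 'Z_n) == 0) = (n %| k)%N.
Proof. by rewrite -val_eqE /= val_Zp_nat. Qed.

Lemma Zn_ltn (x : 'Z_n) : (x < n)%N.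
Proof. by rewrite -[X in (_ < X)%N](Zp_cast n_gt1). Qed.

(** The representative of [c] lies strictly between 0 and [n], so its double can only be [n]
    itself. *)
Lemma Zn_involution (c : 'Z_n) : c + c = 0 -> c != 0 ->
  ~~ odd n /\ c = (n %/ 2)%:R.
Proof.
rewrite -[c]natr_Zp -natrD => /eqP; rewrite !Zn_nat_eq0 => /dvdnP[k Hk] ndvd.
have := Zn_ltn c; move: ndvd Hk; move: (nat_of_ord c) => {}c ndvd Hk ltcn.
have c0 : c <> 0%N by move=> e; rewrite e dvdn0 in ndvd.
have k1 : k = 1%N by nia.
have nc : n = (c * 2)%N by lia.
by rewrite nc oddM andbF mulnK.
Qed.

Lemma odd_Zn_nat k : ~~ odd n -> odd (k%:R%R : 'Z_n) = odd k.
Proof.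
move=> even_n; rewrite val_Zp_nat // [in RHS](divn_eq k n) oddD oddM.
by rewrite (negPf even_n) andbF.
Qed.

Lemma odd_ZnD (x y : 'Z_n) : ~~ odd n -> odd (x + y)%R = odd x (+) odd y.
Proof.
move=> even_n; rewrite -[in LHS](natr_Zp x) -[in LHS](natr_Zp y).
by rewrite -natrD odd_Zn_nat ?oddD.
Qed.

Lemma odd_ZnN (x : 'Z_n) : ~~ odd n -> odd (- x)%R = odd x.
Proof.
move=> even_n; have := odd_ZnD x (- x) even_n.
by rewrite subrr /=; do 2!case: odd.
Qed.

Lemma odd_ZnM (x y : 'Z_n) : ~~ odd n -> odd (x * y)%R = odd x && odd y.
Proof.
move=> even_n; rewrite -[in LHS](natr_Zp x) -[in LHS](natr_Zp y).
by rewrite -natrM odd_Zn_nat ?oddM.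
Qed.

Lemma odd_Zn1 : ~~ odd n -> odd (1%R : 'Z_n).
Proof. by move=> even_n; rewrite (odd_Zn_nat 1). Qed.

(** If all of [S] were even, 1 could not be reached from 0; if all were odd, parity would be a
    bipartition. *)
Lemma odd_mixed (S : {set 'Z_n}) : ~~ odd n ->
  graph_connected (Cay S) -> ~ graph_bipartite (Cay S) ->
  (exists2 s, s \in S & odd s) /\ (exists2 s, s \in S & ~~ odd s).
Proof.
move=> even_n conn nbip; split; apply/exists_inP.
  apply: contraT => /exists_inPn allS.
  suff : ~~ odd (1%R : 'Z_n) by rewrite odd_Zn1.
  apply: (Cay_ind (P := fun x => ~~ odd x) conn) => // x s even_x Ss.
  by rewrite odd_ZnD // (negPf even_x) allS.
apply: contra_notT nbip => /exists_inPn allS.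
exists [set x : 'Z_n | odd x]; apply: Cay_edge => x s /allS; rewrite negbK => os.
by rewrite !inE odd_ZnD // os; case: odd.
Qed.

End Zn.

(** * Connection sets made of two opposite pairs *)

Section PmSet.

Variables (n : nat) (a b : 'Z_n).
Hypotheses (n_gt1 : (1 < n)%N) (S4 : #|pm_set a b| = 4).

Let S := pm_set a b.

Lemma in_pm_set u : (u \in S) = [|| u == a, u == - a, u == b | u == - b].
Proof. by rewrite !inE -!orbA. Qed.

Lemma pm_set_neq : [/\ a != - a, b != - b, a != b & a != - b].
Proof.
move: S4; rewrite /pm_set -!setUA !cardsU1 cards1 !inE.
by do 6!case: (_ == _).
Qed.

Lemma pm_set_opp s : s \in S -> - s \in S.
Proof. by rewrite !in_pm_set !eqr_oppLR !opprK; do 4!case: (_ == _). Qed.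

Lemma pm_set_dbl s : s \in S -> s + s != 0.
Proof.
have [aN bN _ _] := pm_set_neq.
rewrite in_pm_set addr_eq0 => /or4P[] /eqP-> //; rewrite opprK eq_sym //.
Qed.

Lemma pm_set_four s t u : s \in S -> t \in S -> u \in S -> t != s -> t != - s ->
  [|| u == s, u == - s, u == t | u == - t].
Proof.
rewrite !in_pm_set => /or4P[] /eqP-> /or4P[] /eqP-> /or4P[] /eqP->;
  by rewrite ?opprK ?eqxx ?orbT.
Qed.

Hypotheses (conn : graph_connected (Cay S)) (nbip : ~ graph_bipartite (Cay S))
  (tfree : twin_free (Cay S)).

(** If [s + s = t + t], translation by [s - t] swaps [s] with [t] and [- s] with [- t], so 0 and
    [s - t] are twins. *)
Lemma pm_set_dbl_inj s t : s \in S -> t \in S -> t != s -> t != - s ->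
  s + s != t + t.
Proof.
move=> Ss St ts tNs; apply/eqP => e.
have shift u : u \in S -> u + (s - t) \in S.
  move=> Su; case/or4P: (pm_set_four Ss St Su ts tNs) => /eqP->.
  - suff -> : s + (s - t) = t by [].
    by apply: (eq_of_sub e); ring.
  - have -> : - s + (s - t) = - t by ring.
    exact: pm_set_opp.
  - by have -> : t + (s - t) = s by ring.
  - suff -> : - t + (s - t) = - s by apply: pm_set_opp.
    by apply: (eq_of_sub e); ring.
suff : s - t = 0 by move/eqP; rewrite subr_eq0 eq_sym (negPf ts).
apply: tfree; apply/setP=> w; rewrite !inE /Cay subr0.
have N : w - (s - t) = w + (s - t).
  by apply: (eq_of_sub (esym e)); ring.
apply/idP/idP => [/shift|]; last by rewrite N; apply: shift.
by have -> : w - (s - t) + (s - t) = w by ring.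
Qed.

(** Any other [u] would give [r *+ 4 = 0], an element of [S] three times another, or equal doubles
    in different pairs. *)
Lemma pm_set_uniq_common r : r \in S -> r *+ 4 != 0 ->
  (forall s t, s \in S -> t \in S -> t != s -> t != - s -> t != s *+ 3) ->
  forall u, u \in S -> u + (r + r) \in S -> u = - r.
Proof.
move=> Sr r4 no3 u Su Sv.
have dbl := pm_set_dbl; have SN := pm_set_opp.
have [eur|nur] := eqVneq u r.
  have [e|n3] := eqVneq (r *+ 3) r.
    by case/eqP: (dbl _ Sr); apply: (eq_of_sub e); ring.
  have [e|n3N] := eqVneq (r *+ 3) (- r).
    by case/eqP: r4; apply: (eq_of_sub e); ring.
  have S3r : r *+ 3 \in S by move: Sv; rewrite eur; congr (_ \in S); ring.
  by have := no3 _ _ Sr S3r n3 n3N; rewrite eqxx.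
have [//|nuNr] := eqVneq u (- r).
case/or4P: (pm_set_four Sr Su Sv nur nuNr) => /eqP e.
- by apply: (eq_of_sub e); ring.
- have := no3 _ _ (SN _ Sr) Su; rewrite opprK nur nuNr => /(_ isT isT)/eqP[].
  by apply: (eq_of_sub e); ring.
- by case/eqP: (dbl _ Sr); apply: (eq_of_sub e); ring.
- have := pm_set_dbl_inj (SN _ Sr) Su; rewrite opprK => /(_ nuNr nur)/eqP[].
  by apply: (eq_of_sub (esym e)); ring.
Qed.

(** The other choices, [u = s] and [u = - t], lead for each [v] to [t = s], a vanishing double,
    equal doubles, or a triple. *)
Lemma pm_set_quad s t u v :
  (forall s t, s \in S -> t \in S -> t != s -> t != - s -> t != s *+ 3) ->
  s \in S -> t \in S -> u \in S -> v \in S ->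
  t != s -> t != - s -> s + u = t + v -> u = - s \/ u = t.
Proof.
move=> no3 Ss St Su Sv ts tNs e.
have dbl := pm_set_dbl; have SN := pm_set_opp.
case/or4P: (pm_set_four Ss St Su ts tNs) => /eqP eu; [|by left|by right|];
  subst u; case/or4P: (pm_set_four Ss St Sv ts tNs) => /eqP ev; subst v.
- by case/eqP: ts; apply: (eq_of_sub (esym e)); ring.
- case/eqP: (no3 _ _ Ss St ts tNs); apply: (eq_of_sub (esym e)); ring.
- case/eqP: (pm_set_dbl_inj Ss St ts tNs); exact: e.
- case/eqP: (dbl _ Ss); apply: (eq_of_sub e); ring.
- case/eqP: (dbl _ St); apply: (eq_of_sub (esym e)); ring.
- case/eqP: (pm_set_dbl_inj Ss St ts tNs); apply: (eq_of_sub e); ring.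
- have [st sNt] : s != t /\ s != - t.
    by rewrite eq_sym ts -eqr_oppLR eq_sym.
  case/eqP: (no3 _ _ St Ss st sNt); apply: (eq_of_sub e); ring.
- by case/eqP: ts; apply: (eq_of_sub (esym e)); ring.
Qed.

(** Otherwise [a + a] and [b + b] would both be the unique involution [n / 2], against
    [pm_set_dbl_inj]. *)
Lemma pm_set_four_neq0 : exists2 r, r \in S & r *+ 4 != 0.
Proof.
have [aN bN ab aNb] := pm_set_neq.
have Sa : a \in S by rewrite in_pm_set eqxx.
have Sb : b \in S by rewrite in_pm_set eqxx !orbT.
have [a4|] := eqVneq (a *+ 4) 0; last by exists a.
have [b4|] := eqVneq (b *+ 4) 0; last by exists b.
have inv u : u \in S -> u *+ 4 = 0 -> u + u = (n %/ 2)%:R.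
  move=> /pm_set_dbl u2 u4; apply: (Zn_involution n_gt1 _ u2).2.
  by rewrite -u4; ring.
have := pm_set_dbl_inj Sb Sa ab aNb.
by rewrite (inv a) ?(inv b) ?eqxx.
Qed.

Lemma pm_set_triple_eq f g r : injective f -> injective g ->
  (forall x y, (g y - f x \in S) = (y - x \in S)) ->
  r \in S -> r *+ 3 \in S -> r *+ 3 != r -> r *+ 3 != - r ->
  forall x, f x = g x.
Proof.
move=> f_inj g_inj fg Sr S3r n3 n3N.
have dbl := pm_set_dbl; have SN := pm_set_opp.
have SP u (Su : u \in S) := pm_set_four Sr S3r Su n3 n3N.
(* For even [n], all of [S] would share the parity of [r], contradicting [odd_mixed]. *)
have odd_n (c : 'Z_n) : c + c = 0 -> c = 0.
  move=> c2; apply/eqP; apply: contraT => cn0.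
  have [even_n _] := Zn_involution n_gt1 c2 cn0.
  have odd3 : odd (r *+ 3)%R = odd r.
    rewrite !mulrSr mulr0n add0r !odd_ZnD //; by case: odd.
  have oddS u : u \in S -> odd u = odd r.
    by move/SP=> /or4P[]/eqP->; rewrite ?odd_ZnN ?odd3.
  have [[s /oddS->] + [t /oddS->]] := odd_mixed n_gt1 even_n conn nbip.
  by move=> ->.
(* Here [S] contains all nonzero elements, so [f x] and [g x], if distinct, would be adjacent,
   although [x] is not adjacent to itself. *)
have [r5|r5] := eqVneq (r *+ 5) 0.
  have mulr_r x : exists k, x = r *+ k.
    elim/(Cay_ind conn): x => [|x s [k ->] /SP]; first by exists 0%N.
    case/or4P=> /eqP->; [exists k.+1|exists (k + 4)%N|exists (k + 3)%N|exists (k + 2)%N];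
      rewrite ?mulrSr ?mulrnDr //; try by ring.
    - by apply: (eq_of_sub (esym r5)); ring.
    - by apply: (eq_of_sub (esym r5)); ring.
  have inS x : x != 0 -> x \in S.
    have [k ->] := mulr_r x.
    rewrite (divn_eq k 5) mulrnDr mulnC mulrnA r5 mul0rn add0r.
    have := ltn_pmod k (isT : 0 < 5)%N.
    case: (k %% 5)%N => [|[|[|[|[|?]]]]] // _; rewrite ?mulr0n ?eqxx ?mulr1n // => _.
      suff -> : r *+ 2 = - (r *+ 3) by apply: SN.
      by apply: (eq_of_sub r5); ring.
    suff -> : r *+ 4 = - r by apply: SN.
    by apply: (eq_of_sub r5); ring.
  move=> x; apply/eqP; apply: contraT => fgx.
  have : g x - f x \in S by apply: inS; rewrite subr_eq0 eq_sym.
  by rewrite fg subrr => /dbl; rewrite addr0 eqxx.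
(* With [u] and [v] among [r], [- r], [r *+ 3], [- (r *+ 3)], the equation [u + r *+ 6 = v] makes an
   even multiple of [r], from 2 to 12, vanish unless [u = - (r *+ 3)]. *)
have n4 : r *+ 4 <> 0.
  by move=> e; case/eqP: n3N; apply: (eq_of_sub e); ring.
have n2 : r *+ 2 <> 0.
  by move=> e; case/eqP: (dbl _ Sr); apply: (eq_of_sub e); ring.
have n6 : r *+ 6 <> 0.
  by move=> e; case/eqP: (dbl _ S3r); apply: (eq_of_sub e); ring.
have n8 : r *+ 8 <> 0.
  by move=> e; apply/n4/odd_n; apply: (eq_of_sub e); ring.
have n12 : r *+ 12 <> 0.
  by move=> e; apply/n6/odd_n; apply: (eq_of_sub e); ring.
have n10 : r *+ 10 <> 0.
  by move=> e; case/eqP: r5; apply/odd_n; apply: (eq_of_sub e); ring.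
apply: (two_fold_triple_eq SN dbl pm_set_four conn nbip f_inj g_inj fg Sr) => //.
move=> u /SP Su /SP Sv.
case/or4P: Su Sv => /eqP-> // /or4P[] /eqP e; exfalso;
  by first [apply: n2; apply: (eq_of_sub e); ring
           |apply: n4; apply: (eq_of_sub e); ring
           |apply: n6; apply: (eq_of_sub e); ring
           |apply: n8; apply: (eq_of_sub e); ring
           |apply: n10; apply: (eq_of_sub e); ring
           |apply: n12; apply: (eq_of_sub e); ring].
Qed.

Lemma pm_set_affine : unstable (Cay S) ->
  exists m : 'Z_n, [/\ ~~ odd n, m \is a GRing.unit &
    forall s, s \in S -> m * s + (n %/ 2)%:R \in S].
Proof.
case/(unstable_two_fold conn nbip) => f [g [f_inj g_inj fg nfg]].
have {}fg x y : (g y - f x \in S) = (y - x \in S) := fg x y.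
have [/exists_inP[r Sr /and3P[S3r n3 n3N]]|/exists_inPn no3] :=
  boolP [exists r in S, [&& r *+ 3 \in S, r *+ 3 != r & r *+ 3 != - r]].
  by case: nfg => x []; apply: (pm_set_triple_eq f_inj g_inj fg Sr).
have {}no3 s t : s \in S -> t \in S -> t != s -> t != - s -> t != s *+ 3.
  move=> Ss St ts tNs; apply: contraNneq (no3 s Ss) => <-.
  by rewrite St ts tNs.
have [r Sr r4] := pm_set_four_neq0.
have [m [c [mU cn0 c2 mS]]] := two_fold_affine pm_set_opp pm_set_dbl pm_set_four
  conn nbip f_inj g_inj fg Sr (pm_set_uniq_common Sr r4 no3)
  (fun s t u v => pm_set_quad no3) nfg.
have [even_n ec] := Zn_involution n_gt1 c2 cn0.
by exists m; split=> // s /mS; rewrite ec.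
Qed.

End PmSet.

(** The quotient of [k * 2] by [d] is odd, as otherwise [d] would divide [k]; so the factor 4 of
    [k * 2] lies in [d]. *)
Lemma dvdn4_of_half k d : ~~ odd k -> (d %| k * 2)%N -> ~~ (d %| k)%N -> (4 %| d)%N.
Proof.
move=> even_k /dvdnP[x kx] ndvd.
have odd_x : odd x.
  apply: contraNT ndvd => even_x; apply/dvdnP; exists x./2.
  by have := odd_double_half x; rewrite (negPf even_x); nia.
rewrite -(Gauss_dvdr (n := x) d) -?kx.
  by apply: (@dvdn_mul 2 2); rewrite ?dvdn2.
by rewrite (coprimeXl 2 (_ : coprime 2 x)) // coprime2n.
Qed.

(** Let [k] be the part of [n] prime to [m]. Each prime factor of [n] then divides exactly one of
    [m] and [k * l]. *)
Lemma coprime_lift m l n : (0 < m)%N -> (0 < n)%N -> coprime m l ->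
  exists k, coprime (m + k * l) n.
Proof.
move=> m0 n0 cml; pose k := (n`_(\pi(m)^'))%N; exists k.
rewrite /coprime eqn_leq gcdn_gt0 n0 orbT andbT leqNgt; apply/negP=> g1.
have p_pr := pdiv_prime g1; set p := pdiv _ in p_pr.
have := pdiv_dvd (gcdn (m + k * l) n); rewrite -/p dvdn_gcd => /andP[pmkl pn].
have p_k : (p %| k)%N = ~~ (p %| m)%N.
  have := pi_of_part (\pi(m)^') n0 p; rewrite -/k !inE !mem_primes.
  by rewrite p_pr n0 pn m0 part_gt0.
have [pm|npm] := boolP (p %| m)%N; last first.
  by move: pmkl; rewrite dvdn_addl ?(negPf npm) // dvdn_mulr // p_k.
move: pmkl; rewrite dvdn_addr // Euclid_dvdM // p_k pm /= => pl.
have : (p %| gcdn m l)%N by rewrite dvdn_gcd pm.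
by rewrite (eqP cml) dvdn1 => /eqP p1; rewrite p1 in p_pr.
Qed.

(** * Orders of elements of ['Z_n] *)

Section Order.

Variable n : nat.
Hypothesis n_gt1 : (1 < n)%N.
Implicit Types a b m x : 'Z_n.

Lemma Zn_order_dvd a k : (k%:R * a == 0) = (Zn_order a %| k)%N.
Proof.
rewrite -{1}[a]natr_Zp -natrM Zn_nat_eq0 // /Zn_order.
have g0 : (0 < gcdn n a)%N by rewrite gcdn_gt0; lia.
rewrite -[RHS](dvdn_pmul2r g0) divnK ?dvdn_gcdl // muln_gcdr dvdn_gcd.
by rewrite (dvdn_mull k (dvdnn n)).
Qed.

Lemma Zn_order_gt0 a : (0 < Zn_order a)%N.
Proof.
have n0 : (0 < n)%N := ltnW n_gt1.
by rewrite divn_gt0 ?gcdn_gt0 ?n0 //; apply: dvdn_leq (dvdn_gcdl n a).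
Qed.

(** The order of [a] divides [m * m - 1], written with [n.-1] in place of -1 to stay in [nat]. *)
Lemma coprime_Zn_order m a : m * m * a = a -> coprime m (Zn_order a).
Proof.
move=> mma; have An : (Zn_order a %| n)%N by apply/dvdn_div/dvdn_gcdl.
have : (Zn_order a %| m * m + n.-1)%N.
  rewrite -Zn_order_dvd natrD natrM natr_Zp mulrDl mma.
  rewrite -{1}[a]mul1r -mulrDl nat1r prednK ?(ltnW n_gt1) //.
  by rewrite pchar_Zp // mul0r.
set g := gcdn m (Zn_order a) => dvd.
have gn : (g %| n)%N by apply: dvdn_trans An; apply: dvdn_gcdr.
have : (g %| n.-1)%N.
  rewrite -(@dvdn_addr (m * m)) ?dvdn_mulr ?dvdn_gcdl //.
  by apply: dvdn_trans dvd; apply: dvdn_gcdr.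
by move=> gn1; rewrite /coprime -dvdn1 -(dvdn_addr _ gn1) addn1 prednK ?(ltnW n_gt1).
Qed.

(** * From a shift by [n / 2] to the two families *)

Section Half.

Hypothesis even_n : ~~ odd n.
Let c : 'Z_n := (n %/ 2)%:R.

Lemma half_dbl : c + c = 0.
Proof.
apply/eqP; rewrite -natrD Zn_nat_eq0 // addnn -muln2 divnK ?dvdn2 //.
Qed.

Lemma half_neq0 : c != 0.
Proof. by rewrite Zn_nat_eq0 //; apply/negP=> /dvdn_leq; nia. Qed.

Lemma half_opp : - c = c.
Proof. by apply: (eq_of_sub (esym half_dbl)); ring. Qed.

Lemma mul_half x : x * c = if odd x then c else 0.
Proof.
rewrite -{1}[x]natr_Zp -[X in X%:R * _]odd_double_half natrD -addnn natrD.
rewrite mulrDl mulrDl -mulrDr half_dbl mulr0 addr0.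
by case: odd; rewrite ?mul1r ?mul0r.
Qed.

Lemma odd_unit m : m \is a GRing.unit -> odd m.
Proof.
rewrite -{1}[m]natr_Zp unitZpE // => /(coprime_dvdl (_ : 2 %| n)%N).
by rewrite coprime2n; apply; rewrite dvdn2.
Qed.

(** If [n / 2] is odd, the map [s |-> m * s + c] changes parity and exchanges the two opposite
    pairs, giving [case1]; if it is even, each pair is preserved, giving [case2]. *)
Lemma shift_cases a b m : graph_connected (Cay (pm_set a b)) ->
  m \is a GRing.unit -> odd a -> ~~ odd b ->
  (forall s, s \in pm_set a b -> m * s + c \in pm_set a b) ->
  case1 a b \/ case2 a b.
Proof.
move=> conn mU oa eb mS.
have om := odd_unit mU.
have Sa : m * a + c \in pm_set a b by apply: mS; rewrite in_pm_set eqxx.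
have Sb : m * b + c \in pm_set a b by apply: mS; rewrite in_pm_set eqxx !orbT.
have oc : odd c = odd (n %/ 2) by rewrite /c odd_Zn_nat.
have oma : odd (m * a + c)%R = ~~ odd (n %/ 2).
  by rewrite odd_ZnD // odd_ZnM // om oa oc.
have omb : odd (m * b + c)%R = odd (n %/ 2).
  by rewrite odd_ZnD // odd_ZnM // om (negPf eb) oc.
have [oh|eh] := boolP (odd (n %/ 2)).
  left; rewrite oh in oma omb.
  have [e1 e1s maE] : exists2 e : 'Z_n, e = 1 \/ e = -1 & m * a + c = e * b.
    move: Sa oma; rewrite in_pm_set => /or4P[] /eqP->; rewrite ?odd_ZnN ?oa //.
      by move=> _; exists 1; [left|rewrite mul1r].
    by move=> _; exists (-1); [right|rewrite mulN1r].
  have [e2 e2s mbE] : exists2 e : 'Z_n, e = 1 \/ e = -1 & m * b + c = e * a.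
    move: Sb omb; rewrite in_pm_set => /or4P[] /eqP->; rewrite ?odd_ZnN ?(negPf eb) //.
      by move=> _; exists 1; [left|rewrite mul1r].
    by move=> _; exists (-1); [right|rewrite mulN1r].
  have e1c : e1 * c = c.
    by case: e1s => ->; rewrite ?mul1r // mulN1r half_opp.
  have e1e1 : e1 * e1 = 1 by case: e1s => ->; ring.
  have bE : b = (e1 * m) * a + c.
    rewrite -[b]mul1r -e1e1 -mulrA -maE mulrDr e1c; ring.
  have mc : m * c = c by rewrite mul_half om.
  have ac : a * c = c by rewrite mul_half oa.
  (* Since [c = a * c], the element [b] is a multiple of [a], so by connectedness 1 is one too. *)
  have aU : a \is a GRing.unit.
    have [y e] : exists y, (1 : 'Z_n) = a * y.
      elim/(Cay_ind conn): (1 : 'Z_n) => [|x s [y ->] Ss].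
        by exists 0; rewrite mulr0.
      suff [z ->] : exists z, s = a * z by exists (y + z); rewrite mulrDr.
      have [z bz] : exists z, b = a * z.
        by exists (e1 * m + c); rewrite mulrDr ac {1}bE; ring.
      move: Ss; rewrite in_pm_set => /or4P[] /eqP->.
      - by exists 1; rewrite mulr1.
      - by exists (-1); rewrite mulrN1.
      - by exists z.
      - by exists (- z); rewrite bz mulrN.
    by apply/unitrPr; exists y.
  have m2 : m * m = e1 * e2.
    apply: (mulIr aU).
    have -> : m * m * a = m * (m * a + c) - m * c by ring.
    rewrite maE mc.
    have -> : m * (e1 * b) - c = e1 * (m * b + c) - e1 * c - c by ring.
    rewrite mbE e1c -addrA -opprD half_dbl; ring.
  split.
  - by lia.
  - by rewrite gcdnC; apply/eqP; rewrite -[_ == _](unitZpE a n_gt1) natr_Zp.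
  - exists (e1 * m); split=> //.
      by rewrite unitrMr //; apply/unitrPr; exists e1.
    have -> : (e1 * m) ^+ 2 = e1 * e1 * (m * m) by ring.
    rewrite e1e1 mul1r m2.
    by case: e1s e2s => -> [] ->; [left|right|right|left]; ring.
right; rewrite (negPf eh) in oma omb.
(* The sign of [m1 = m] or [m1 = - m] is chosen so that the shifted map fixes [a]. *)
have [m1 [om1 m1a m1b]] : exists m1 : 'Z_n, [/\ odd m1, m1 * a + c = a &
    m1 * b + c = b \/ m1 * b + c = - b].
  have mbE : m * b + c = b \/ m * b + c = - b.
    move: Sb omb; rewrite in_pm_set => /or4P[] /eqP->; rewrite ?odd_ZnN ?oa //.
      by left.
    by right.
  move: Sa oma; rewrite in_pm_set => /or4P[] /eqP maE;
    rewrite maE ?odd_ZnN ?(negPf eb) // => _; first by exists m.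
  exists (- m); rewrite odd_ZnN //.
  have NE x : - m * x + c = - (m * x + c) by rewrite opprD half_opp; ring.
  by rewrite !NE maE; split=> //; first ring; case: mbE => ->; rewrite ?opprK; [right|left].
pose p := m1 - 1.
have ep : ~~ odd p by rewrite odd_ZnD // odd_ZnN // odd_Zn1 // om1.
have pa : p * a = c.
  by rewrite -half_opp; apply: (eq_of_sub m1a); rewrite /p; ring.
(* If [b] is fixed as well, [p + p] kills the generators, so [p] is 0 or [n / 2]; then [p * b = 0]
   because [b] is even, against [p * b = c]. *)
case: m1b => m1b.
  have pb : p * b = c.
    by rewrite -half_opp; apply: (eq_of_sub m1b); rewrite /p; ring.
  have p2 : p + p = 0.
    rewrite -[LHS]mulr1; elim/(Cay_ind conn): (1 : 'Z_n) => [|x s IHx Ss].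
      by rewrite mulr0.
    rewrite mulrDr IHx add0r mulrDl.
    have : p * s = c.
      move: Ss; rewrite in_pm_set.
      by case/or4P => /eqP->; rewrite ?mulrN ?pa ?pb ?half_opp.
    by move->; exact: half_dbl.
  have := half_neq0; rewrite -pb.
  have [->|/(Zn_involution n_gt1 p2)[_ ->]] := eqVneq p 0.
    by rewrite mul0r eqxx.
  by rewrite mulrC mul_half (negPf eb) eqxx.
have pb : (p + 2%:R) * b = c.
  by rewrite -half_opp; apply: (eq_of_sub m1b); rewrite /p; ring.
have ordA : (Zn_order a %| p * 2)%N && ~~ (Zn_order a %| p)%N.
  rewrite -!Zn_order_dvd natrM natr_Zp pa half_neq0 andbT.
  by rewrite mulr_natr mulrnAl pa mulr2n half_dbl.
have ordB : (Zn_order b %| (p + 2) * 2)%N && ~~ (Zn_order b %| p + 2)%N.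
  rewrite -!Zn_order_dvd natrM natrD natr_Zp pb half_neq0 andbT.
  by rewrite mulr_natr mulrnAl pb mulr2n half_dbl.
case/andP: ordA => A1 A2; case/andP: ordB => B1 B2.
have A4 := dvdn4_of_half ep A1 A2.
have B4 : (4 %| Zn_order b)%N.
  by apply: dvdn4_of_half B1 B2; rewrite oddD addbF.
(* The order of [b] is divisible by 4 and its cofactor [gcdn n b] is even; the gcd of the two orders
   divides the difference 4 of [(p + 2) * 2] and [p * 2]. *)
split.
  have -> : n = (Zn_order b * gcdn n b)%N by rewrite divnK // dvdn_gcdl.
  by apply: (@dvdn_mul 4 2) => //; rewrite dvdn_gcd !dvdn2 even_n.
apply/eqP; rewrite eqn_dvd dvdn_gcd A4 B4 !andbT.
rewrite -(@dvdn_addr (p * 2)); last exact: dvdn_trans (dvdn_gcdl _ _) A1.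
have -> : (p * 2 + 4 = (p + 2) * 2)%N by rewrite mulnDl.
exact: dvdn_trans (dvdn_gcdr _ _) B1.
Qed.

End Half.

(** * Wilson type (C.4) for both families, and instability from it *)

Lemma wilson_of_shift a b m : ~~ odd n -> m \is a GRing.unit ->
  m * a + (n %/ 2)%:R \in pm_set a b -> m * b + (n %/ 2)%:R \in pm_set a b ->
  wilson_C4 (pm_set a b).
Proof.
move=> even_n mU Sa Sb; split=> //; exists m => //.
have minj : injective (fun s => (n %/ 2)%:R + m * s) by move=> s t /addrI/(mulrI mU).
apply/eqP; rewrite eqEcard card_imset // leqnn andbT.
apply/subsetP=> _ /imsetP[s + ->].
(* As [n / 2] is its own opposite, only [a] and [b] need checking. *)
have N x : (n %/ 2)%:R + m * - x = - (m * x + (n %/ 2)%:R).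
  by rewrite opprD half_opp // mulrN addrC.
rewrite in_pm_set => /or4P[] /eqP->; rewrite ?N ?pm_set_opp //; by rewrite addrC.
Qed.

(** The shifted map sends [a] to [b], and [b] to [m * m * a], since the two copies of [n / 2]
    cancel. *)
Lemma case1_wilson a b : case1 a b -> wilson_C4 (pm_set a b).
Proof.
case=> n4 _ [m [mU m2 bE]].
have even_n : ~~ odd n by lia.
apply: (wilson_of_shift even_n mU); first by rewrite -bE in_pm_set eqxx !orbT.
rewrite bE mulrDr mul_half // (odd_unit even_n mU) -addrA half_dbl // addr0.
rewrite mulrA -expr2; case: m2 => ->; rewrite ?mul1r ?mulN1r in_pm_set eqxx ?orbT //.
Qed.

Lemma case2_wilson a b : case2 a b -> wilson_C4 (pm_set a b).
Proof.
case=> n8 AB4.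
have even_n : ~~ odd n by lia.
set c : 'Z_n := (n %/ 2)%:R.
have [A4 B4] : (4 %| Zn_order a)%N /\ (4 %| Zn_order b)%N.
  by rewrite -AB4 dvdn_gcdl dvdn_gcdr.
have [A AE] := dvdnP A4; have [B BE] := dvdnP B4.
have half x k : Zn_order x = (k * 4)%N -> (k * 2)%:R * x = c.
  move=> ox; have ox0 : (0 < k * 4)%N.
    by rewrite -ox Zn_order_gt0.
  apply: (Zn_involution n_gt1 _ _).2.
    by apply/eqP; rewrite -mulrDl -natrD Zn_order_dvd ox -mulnDr.
  by rewrite Zn_order_dvd ox; apply/negP=> /dvdn_leq; lia.
have cA := half _ _ AE; have cB := half _ _ BE.
have A0 : (A * 4)%:R * a = 0 by apply/eqP; rewrite Zn_order_dvd AE.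
have B0 : (B * 4)%:R * b = 0 by apply/eqP; rewrite Zn_order_dvd BE.
have [u [v uv]] : exists u v : 'Z_n, 4%:R = u * (A * 4)%:R + v * (B * 4)%:R.
  have A40 : (0 < A * 4)%N by rewrite -AE Zn_order_gt0.
  have [w _ /dvdnP[t Ht]] := Bezoutl (B * 4) A40.
  exists t%:R, (- w%:R).
  rewrite mulNr -!natrM -Ht natrD addrK -AE -BE AB4 //.
(* The sign [e] is 1 exactly when [A] and [B] have the same parity. *)
have [q [e [e1 qE]]] : exists q e : 'Z_n, (e = 1 \/ e = -1) /\
    1 - e + (A * 2)%:R - (B * 2)%:R = q * 4%:R.
  rewrite -(odd_double_half A) -(odd_double_half B) -!muln2.
  case: (odd A); case: (odd B); rewrite /nat_of_bool.
  - by exists (A./2%:R - B./2%:R), 1; split; [left|ring].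
  - by exists (A./2%:R - B./2%:R + 1), (-1); split; [right|ring].
  - by exists (A./2%:R - B./2%:R), (-1); split; [right|ring].
  - by exists (A./2%:R - B./2%:R), 1; split; [left|ring].
(* [m] is [1 + |a| / 2] modulo [|a|] and [e + |b| / 2] modulo [|b|]; the sign [e]
   makes the two residues agree modulo [gcd(|a|, |b|) = 4]. *)
pose m := 1 + (A * 2)%:R - q * u * (A * 4)%:R.
have ma : m * a + c = a.
  have -> : m * a + c = a + ((A * 2)%:R * a + c) - q * u * ((A * 4)%:R * a).
    by rewrite /m; ring.
  by rewrite cA A0 half_dbl // mulr0 addr0 subr0.
have mb : m * b + c = e * b.
  have -> : m * b + c = e * b + ((B * 2)%:R * b + c) + (1 - e + (A * 2)%:R - (B * 2)%:R) * b
       - q * (u * (A * 4)%:R) * b by rewrite /m; ring.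
  rewrite cB half_dbl // addr0 qE uv.
  have -> : e * b + q * (u * (A * 4)%:R + v * (B * 4)%:R) * b - q * (u * (A * 4)%:R) * b
     = e * b + q * v * ((B * 4)%:R * b) by ring.
  by rewrite B0 mulr0 addr0.
have om : odd m.
  rewrite /m odd_ZnD // odd_ZnD // odd_ZnN // odd_ZnM // !odd_Zn_nat //.
  by rewrite !oddM !andbF odd_Zn1.
have mc : m * c = c by rewrite mul_half // om.
have ec : e * c = c by case: e1 => ->; rewrite ?mul1r // mulN1r half_opp.
have mma : m * m * a = a.
  have -> : m * m * a = m * (m * a + c) - m * c by ring.
  by rewrite ma mc half_opp // ma.
have mmb : m * m * b = b.
  have -> : m * m * b = m * (m * b + c) - m * c by ring.
  rewrite mb mc.
  have -> : m * (e * b) - c = e * (m * b + c) - e * c - c by ring.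
  rewrite mb ec -addrA -opprD half_dbl // subr0 mulrA.
  by case: e1 => ->; ring.
have m_gt0 : (0 < m)%N by move: om; case: (nat_of_ord m).
have cop : coprime m (Zn_order a * Zn_order b).
  by rewrite coprimeMr !coprime_Zn_order.
(* So far [m] is only known to be coprime to the two orders; [m'] is a unit modulo [n] with the same
   action on [a] and [b]. *)
have [k copn] := coprime_lift m_gt0 (ltnW n_gt1) cop.
pose m' : 'Z_n := (m + k * (Zn_order a * Zn_order b))%:R.
have m'E x : x = a \/ x = b -> m' * x = m * x.
  move=> xab; rewrite /m' natrD natr_Zp mulrDl.
  have /eqP-> : (k * (Zn_order a * Zn_order b))%:R * x == 0.
    rewrite Zn_order_dvd; apply: dvdn_mull.
    by case: xab => ->; [apply: dvdn_mulr|apply: dvdn_mull].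
  by rewrite addr0.
apply: (@wilson_of_shift _ _ m') => //.
- by rewrite unitZpE // coprime_sym.
- by rewrite m'E ?ma ?in_pm_set ?eqxx //; left.
- rewrite m'E ?mb ?in_pm_set; last by right.
  by case: e1 => ->; rewrite ?mul1r ?mulN1r eqxx !orbT.
Qed.

(** Multiplying by [m] on both sides and translating by [n / 2] on one side only is an automorphism
    of the double cover, but moves 0 differently on the two sides. *)
Lemma wilson_unstable (S : {set 'Z_n}) : wilson_C4 S -> unstable (Cay S).
Proof.
case=> even_n [m mU mS] stab.
set c : 'Z_n := (n %/ 2)%:R in mS.
pose F (p : 'Z_n * 'I_2) : 'Z_n * 'I_2 := (m * p.1 + p.2%:R * c, p.2).
have F_inj : injective F.
  move=> [x i] [y j] e; have eij : i = j := congr1 snd e.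
  by have := congr1 fst e; rewrite /F /= eij => /addIr/(mulrI mU)->.
have SE x : (m * x + c \in S) = (x \in S).
  rewrite -{1}mS addrC; apply/imsetP/idP => [[y Sy /addrI/(mulrI mU)->] //|Sx].
  by exists x.
have : perm F_inj \in graph_aut (double_cover (Cay S)).
  rewrite inE; apply/forallP=> -[x i]; apply/forallP=> -[y j].
  rewrite !permE /double_cover /F /=; apply/eqP.
  have [//|ij] := eqVneq i j.
  rewrite /= /Cay -[RHS]SE; congr (_ \in S).
  have -> : m * y + j%:R * c - (m * x + i%:R * c) = m * (y - x) + (j%:R * c - i%:R * c).
    by ring.
  congr (_ + _); case: i j ij => -[|[|i]] // li [[|[|j]] // lj] ij /=.
    by rewrite mul0r mul1r subr0.
  by rewrite mul0r mul1r sub0r half_opp.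
rewrite stab => /imsetP[[s t] _ /permP e].
have := e (0, ord0); have := e (0, ord_max).
rewrite !permE /F /prod_perm_fun /= !mulr0 !add0r mul0r mul1r => -[<- _] -[c0 _].
by have := half_neq0 even_n; rewrite -/c -c0 eqxx.
Qed.

End Order.

Theorem theorem4p3 (n : nat) (n_gt1 : (1 < n)%N) (a b : 'Z_n)
    (S_no0 : 0 \notin pm_set a b)
    (valency4 : has_valency (Cay (pm_set a b)) 4) :
  (unstable (Cay (pm_set a b)) <->
     trivially_unstable (Cay (pm_set a b)) \/
     ((case1 a b \/ case2 a b) \/ (case1 b a \/ case2 b a))) /\
  ((case1 a b \/ case2 a b) \/ (case1 b a \/ case2 b a) ->
     wilson_C4 (pm_set a b)).
Proof.
have pmC : pm_set b a = pm_set a b.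
  by apply/setP=> u; rewrite !in_pm_set; do 4!case: (_ == _).
have wilson : (case1 a b \/ case2 a b) \/ (case1 b a \/ case2 b a) ->
    wilson_C4 (pm_set a b).
  case=> [|] [/(case1_wilson n_gt1)|/(case2_wilson n_gt1)] //; by rewrite pmC.
split=> //; split; last by case=> [[]|/wilson/(wilson_unstable n_gt1)].
move=> unst; case: (Classical_Prop.classic (nontrivially_unstable (Cay (pm_set a b)))).
  case=> conn nbip tfree _; right.
  have S4 : #|pm_set a b| = 4.
    have <- : nbhd (Cay (pm_set a b)) 0 = pm_set a b; last exact: valency4.
    by apply/setP=> u; rewrite inE /Cay subr0.
  have [m [even_n mU mS]] := pm_set_affine n_gt1 S4 conn nbip tfree unst.
  have [[s Ss os] [t St et]] := odd_mixed n_gt1 even_n conn nbip.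
  have odd_S u : u \in pm_set a b -> (odd u = odd a) \/ (odd u = odd b).
    by rewrite in_pm_set => /or4P[] /eqP->; rewrite ?odd_ZnN //; auto.
  (* Exactly one of [a] and [b] is odd; it takes the first place. *)
  have [oa|ea] := boolP (odd a).
    left; apply: (shift_cases n_gt1 even_n conn mU oa) => //.
    by case: (odd_S t St) et => ->; rewrite ?oa.
  right; apply: (@shift_cases _ n_gt1 even_n b a m); rewrite ?pmC //.
  by case: (odd_S s Ss) os => ->; rewrite ?(negPf ea).
by left.
Qed.
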